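(* Let $\mathcal T=(S,\Sigma,\kappa)$ be a stochastic transition system, $\mu\in\mathrm{Dist}(S)$ and $B\in\Sigma$. For $n\in\mathbb N$ let $$p_n^{\mathrm{Yes}}=\mathrm{Prob}^{\mathcal T}_\mu(\mathbf F_{\le n}B),\qquad p_n^{\mathrm{No}}=\mathrm{Prob}^{\mathcal T}_\mu(\neg B\,\mathbf U_{\le n}\,\widetilde B).$$ If $\mathcal T$ is decisive w.r.t. $B$ from $\mu$, then the two sequences $(p_n^{\mathrm{Yes}})_n$ and $(1-p_n^{\mathrm{No}})_n$ are adjacent and converge to $\mathrm{Prob}^{\mathcal T}_\mu(\mathbf F B)$.
   Context: A stochastic transition system (STS) is $\mathcal T=(S,\Sigma,\kappa)$ where $(S,\Sigma)$ is a measurable space and $\kappa:S\times\Sigma\to[0,1]$ is a Markov kernel. $\mathrm{Dist}(S)$ is the set of probability measures on $(S,\Sigma)$; $\delta_s$ is the Dirac measure. For $\mu\in\mathrm{Dist}(S)$, $\mathrm{Prob}^{\mathcal T}_\mu$ is the law on infinite paths $s_0s_1\dots\in S^\omega$ (cylinder $\sigma$-algebra) of the Markov chain with initial distribution $\mu$ and kernel $\kappa$. Events: $\mathbf F B$: $\exists i\ge0,\ s_i\in B$; $\mathbf F_{\le n}B$: $\exists\,0\le i\le n,\ s_i\in B$; $\neg B\,\mathbf U_{\le n}\,C$: $\exists\,0\le i\le n$ with $s_i\in C$ and $s_j\notin B$ for all $0\le j<i$. Avoid-set: $\widetilde B=\{s\in S\mid\mathrm{Prob}^{\mathcal T}_{\delta_s}(\mathbf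 F B)=0\}$ (it belongs to $\Sigma$). $\mathcal T$ is decisive w.r.t. $B$ from $\mu$ if $\mathrm{Prob}^{\mathcal T}_\mu(\mathbf F B\vee\mathbf F\widetilde B)=1$. Two real sequences are adjacent if one is non-decreasing, the other is non-increasing, and their difference converges to $0$. *)

(* Defs.v *)
From HB Require Import structures.
From mathcomp Require Import all_boot all_order all_algebra.
From mathcomp Require Import all_classical all_reals all_analysis.
From mathcomp Require Import measurable_realfun.

Set Implicit Arguments.
Unset Strict Implicit.
Unset Printing Implicit Defensive.
Import Order.TTheory GRing.Theory Num.Theory.
Import numFieldNormedType.Exports.
Local Open Scope classical_set_scope.
Local Open Scope ring_scope.

(* Stochastic transition systems are represented by a measurable space S
   together with a probability kernel kappa : R.-pker S ~> S. *)

Definition coordinate_cylinders d (S : measurableType d) : set (set (nat -> S)) :=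
  [set C | exists i A, measurable A /\ C = [set w | A (w i)]].

Arguments coordinate_cylinders {d} S _.

(* S^omega with the cylinder sigma-algebra *)
Definition infpath d (S : measurableType d) : measurableType _ :=
  g_sigma_algebraType (coordinate_cylinders S).

Local Open Scope ereal_scope.

(* cylinder_mass kappa A n s is the probability, starting from s, that the
   next n states lie in A 0, ..., A n.-1 respectively, that is
   \int[kappa s]_(t1 in A 0) ... \int[kappa t_(n-1)]_(tn in A n.-1) 1 *)
Fixpoint cylinder_mass d (S : measurableType d) (R : realType)
    (kappa : R.-pker S ~> S) (A : nat -> set S) (n : nat) (s : S) : \bar R :=
  if n is m.+1 then
    \int[kappa s]_(t in A 0%N) cylinder_mass kappa (fun i => A i.+1) m t
  else 1.

Definition is_chain_law d (S : measurableType d) (R : realType)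
    (kappa : R.-pker S ~> S) (mu : probability S R)
    (P : probability (infpath S) R) : Prop :=
  forall (A : nat -> set S) (n : nat), (forall i, measurable (A i)) ->
    P [set w : nat -> S | forall i, (i <= n)%N -> A i (w i)] =
    \int[mu]_(s in A 0%N) cylinder_mass kappa (fun i => A i.+1) n s.

Lemma measurable_coordinate d (S : measurableType d) (i : nat) (A : set S) : measurable A ->
  measurable ([set w | A (w i)] : set (infpath S)).
Proof. by move=> mA; apply: sub_sigma_algebra; exists i, A. Qed.

Lemma measurable_rectangle d (S : measurableType d) (A : nat -> set S) n : (forall i, measurable (A i)) ->
  measurable ([set w | forall i, (i <= n)%N -> A i (w i)] : set (infpath S)).
Proof.
move=> mA; rewrite [X in measurable X](_ : _ =
    \bigcap_(i in [set i | (i <= n)%N]) [set w | A i (w i)]).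
  apply: bigcap_measurable; first by exists 0%N.
  by move=> i _; exact: measurable_coordinate.
by apply/seteqP; split => w.
Qed.

Section chain_law_unique.
Context d (S : measurableType d) (R : realType).
Variables (kappa : R.-pker S ~> S) (mu : probability S R).

Let rectangles : set (set (nat -> S)) :=
  [set C | exists (A : nat -> set S) n, (forall i, measurable (A i)) /\
     C = [set w | forall i, (i <= n)%N -> A i (w i)]].

Lemma chain_law_unique (P Q : probability (infpath S) R) :
  is_chain_law kappa mu P -> is_chain_law kappa mu Q ->
  forall E, measurable E -> P E = Q E.
Proof.
move=> hP hQ E mE.
apply: (@measure_unique _ R (infpath S) rectangles (fun=> setT) _ _ _ _ P Q) => //.
- rewrite eqEsubset; split.
  + apply: smallest_sub; first exact: smallest_sigma_algebra.
    move=> _ [i [A [mA ->]]]; apply: sub_gen_smallest.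
    exists (fun j => if j == i then A else setT), i; split.
      by move=> j; case: ifP.
    apply/seteqP; split => w /= => [Aw j ji|]; first by case: eqP => // ->.
    by move=> /(_ i); rewrite leqnn eqxx; exact.
  + apply: smallest_sub; first exact: sigma_algebra_measurable.
    by move=> _ [A [n [mA ->]]]; exact: measurable_rectangle.
- move=> _ _ [A [n [mA ->]]] [B [m [mB ->]]].
  exists (fun i => (if (i <= n)%N then A i else setT) `&`
                   (if (i <= m)%N then B i else setT)), (maxn n m); split.
    by move=> i; apply: measurableI; case: ifP.
  apply/seteqP; split => w /=.
    by move=> [Aw Bw] i _; split; case: ifPn => // h; [exact: Aw|exact: Bw].
  move=> h; split => i im.
    by have [] := h i; rewrite ?im// leq_max im.
  by have [] := h i; rewrite ?im// leq_max im orbT.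
- move=> _; exists (fun=> setT), 0%N; split => //.
  by apply/seteqP; split.
- by rewrite bigcup_const//; exists 0%N.
- by move=> _ [A [n [mA ->]]]; exact: etrans (hP A n mA) (esym (hQ A n mA)).
- by move=> _; rewrite (le_lt_trans (probability_le1 _ _))// ltry.
Qed.

End chain_law_unique.

(* Existence of the law (Ionescu-Tulcea): a premeasure on the algebra of
   cylinders, extended by Caratheodory. *)
Module IonescuTulcea.

Definition upd (S : Type) (w : nat -> S) (n : nat) (s : S) : nat -> S :=
  fun i => if i == n then s else w i.

Section step.
Context d (S : measurableType d) (R : realType).
Variables (kappa : R.-pker S ~> S) (mu : probability S R).

Lemma measurable_coord n : measurable_fun setT (fun w : infpath S => w n).
Proof.
move=> _ A mA; rewrite setTI; apply: sub_sigma_algebra.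
by exists n, A.
Qed.

Lemma measurable_upd n :
  measurable_fun setT (fun z : infpath S * S => upd z.1 n z.2 : infpath S).
Proof.
apply: measurability; first by reflexivity.
move=> _ [_ [i [A [mA ->]]] <-].
rewrite setTI (_ : _ @^-1` _ = (fun z : infpath S * S => upd z.1 n z.2 i) @^-1` A)//.
rewrite -[X in measurable X]setTI.
suff : measurable_fun setT (fun z : infpath S * S => upd z.1 n z.2 i).
  by move=> /(_ measurableT _ mA).
rewrite /upd; case: eqP => _; first exact: measurable_snd.
exact: measurableT_comp (measurable_coord i) measurable_fst.
Qed.

(* conditional law of the n-th state given the path *)
Definition step (n : nat) (w : infpath S) : {measure set S -> \bar R} :=
  if n is m.+1 then kappa (w m) else mu.

Let measurable_step n U : measurable U ->
  measurable_fun [set: infpath S] (step n ^~ U).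
Proof.
move=> mU; case: n => [|n] /=; first exact: measurable_cst.
exact: measurableT_comp (measurable_kernel kappa _ mU) (measurable_coord n).
Qed.

Lemma stepT n w : step n w setT = 1.
Proof. by case: n => [|n]; [exact: probability_setT|exact: prob_kernel]. Qed.

HB.instance Definition _ n :=
  isKernel.Build _ _ _ _ R (step n) (measurable_step n).
HB.instance Definition _ n :=
  Kernel_isProbability.Build _ _ _ _ R (step n) (stepT n).

Lemma step_cst n w (r : \bar R) : \int[step n w]_s r = r.
Proof.
by rewrite (integral_cst _ measurableT) stepT mule1.
Qed.

(* run n m A w: probability of A when the path follows w before time n, is
   sampled from step at times n, ..., n + m - 1, and follows w afterwards *)
Fixpoint run (n m : nat) (A : set (nat -> S)) (w : nat -> S) : \bar R :=
  if m is k.+1 then \int[step n w]_s run n.+1 k A (upd w n s)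
  else (\1_A w)%:E.

Lemma run_ge0 n m A w : 0 <= run n m A w.
Proof.
by elim: m n w => [|m ih] n w /=; [rewrite lee_fin|exact: integral_ge0].
Qed.

Lemma measurable_run n m A : measurable (A : set (infpath S)) ->
  measurable_fun [set: infpath S] (run n m A).
Proof.
move=> mA; elim: m n => [|m ih] n /=.
  exact/measurable_EFinP/measurable_indic.
apply: (@measurable_fun_integral_finite_kernel _ _ _ _ _
  (fun z : infpath S * S => run n.+1 m A (upd z.1 n z.2)) (step n)).
  by move=> z; exact: run_ge0.
exact: measurableT_comp (ih _) (measurable_upd n).
Qed.

Lemma measurable_run_upd n m A w k : measurable (A : set (infpath S)) ->
  measurable_fun [set: S] (fun s => run n m A (upd w k s)).
Proof.
move=> mA.
have mu_ : measurable_fun [set: S] (fun s => upd w k s : infpath S).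
  exact: measurableT_comp (measurable_upd k) (pair1_measurable (w : infpath S)).
exact: measurableT_comp (measurable_run n m mA) mu_.
Qed.

(* A only depends on the first N states *)
Definition level (N : nat) (A : set (nat -> S)) : Prop :=
  forall w v, (forall i, (i < N)%N -> w i = v i) -> A w -> A v.

Lemma level_upd N A n w s : level N A -> (N <= n)%N ->
  \1_A (upd w n s) = \1_A w :> R.
Proof.
move=> lA Nn; rewrite !indicE; congr (_%:R); apply: congr1.
apply/idP/idP; rewrite !inE; apply: lA => i iN; rewrite /upd;
  by rewrite ltn_eqF// (leq_trans iN).
Qed.

Lemma run_stable N A n m w : level N A -> (N <= n + m)%N ->
  run n m.+1 A w = run n m A w.
Proof.
move=> lA; elim: m n w => [|m ih] n w Nnm.
  rewrite addn0 in Nnm => /=.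
  by under eq_integral do rewrite (level_upd _ _ lA Nnm); exact: step_cst.
rewrite [LHS]/= [RHS]/=; apply: eq_integral => s _.
by rewrite -[LHS]/(run n.+1 m.+1 A (upd w n s)) ih// addSnnS.
Qed.

Lemma run_stableD N A n m k w : level N A -> (N <= n + m)%N ->
  run n (m + k) A w = run n m A w.
Proof.
move=> lA Nnm; elim: k => [|k ih]; first by rewrite addn0.
by rewrite addnS (run_stable _ lA) ?ih// addnA (leq_trans Nnm)// leq_addr.
Qed.

(* probability of the cylinder A given the first n states of w; the horizon
   chosen is irrelevant by condE *)
Definition cond (n : nat) (A : set (nat -> S)) (w : nat -> S) : \bar R :=
  run n (get [set N | level N A]) A w.

Lemma condE N A n m w : level N A -> (N <= n + m)%N -> cond n A w = run n m A w.
Proof.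
move=> lA Nnm; rewrite /cond.
have : level (get [set N | level N A]) A.
  by apply: (@getPex _ [set N | level N A]); exists N.
move: (get _) => M lM.
rewrite -(run_stableD m w lM) ?leq_addl// addnC.
by rewrite (run_stableD M w lA).
Qed.

Lemma condS N A n w : level N A ->
  cond n A w = \int[step n w]_s cond n.+1 A (upd w n s).
Proof.
move=> lA; rewrite (condE (m := N.+1) _ lA); last by rewrite addnS -addSn leq_addl.
rewrite [LHS]/=; apply: eq_integral => s _.
by rewrite (condE (m := N) _ lA)// leq_addl.
Qed.

Lemma cond_level N A n w : level N A -> (N <= n)%N -> cond n A w = (\1_A w)%:E.
Proof. by move=> lA Nn; rewrite (condE (m := 0) _ lA)// addn0. Qed.

Lemma cond_ge0 n A w : 0 <= cond n A w.
Proof. exact: run_ge0. Qed.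

Lemma measurable_cond_upd n A w k : measurable (A : set (infpath S)) ->
  measurable_fun [set: S] (fun s => cond n A (upd w k s)).
Proof. exact: measurable_run_upd. Qed.

Lemma level_le N M A : (N <= M)%N -> level N A -> level M A.
Proof. by move=> NM lA w v wv; apply: lA => i iN; apply/wv/(leq_trans iN). Qed.

Lemma run_add n m (A B : set (nat -> S)) w :
  measurable (A : set (infpath S)) -> measurable (B : set (infpath S)) ->
  A `&` B = set0 -> run n m (A `|` B) w = run n m A w + run n m B w.
Proof.
move=> mA mB AB0; elim: m n w => [|m ih] n w /=.
  rewrite -EFinD !indicE -natrD in_setU; congr (_%:R%:E).
  have : ~ ((w \in A) && (w \in B)).
    by rewrite -in_setI AB0 in_set0.
  by case: (w \in A); case: (w \in B).
under eq_integral do rewrite ih.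
apply: ge0_integralD => //.
- by move=> s _; exact: run_ge0.
- exact: measurable_run_upd.
- by move=> s _; exact: run_ge0.
- exact: measurable_run_upd.
Qed.

Definition cyl : set (set (nat -> S)) :=
  [set A | measurable (A : set (infpath S)) /\ exists N, level N A].

Lemma cond_add n (A B : set (nat -> S)) w : cyl A -> cyl B ->
  A `&` B = set0 -> cond n (A `|` B) w = cond n A w + cond n B w.
Proof.
move=> [mA [N lA]] [mB [M lB]] AB0.
have {}lA := level_le (leq_maxl N M) lA.
have {}lB := level_le (leq_maxr N M) lB.
have lAB : level (maxn N M) (A `|` B).
  by move=> w1 v1 wv [/(lA _ _ wv)|/(lB _ _ wv)]; [left|right].
by rewrite !(condE (N := maxn N M) (m := maxn N M)) ?leq_addl// run_add.
Qed.

Lemma cond_lt_step (A : set (nat -> S)) (F : nat -> set (nat -> S)) n w :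
  cyl A -> (forall k, cyl (F k)) ->
  \sum_(k <oo) cond n (F k) w < cond n A w ->
  exists s, \sum_(k <oo) cond n.+1 (F k) (upd w n s) < cond n.+1 A (upd w n s).
Proof.
move=> [mA [N lA]] cF FA; apply: contrapT => /forallNP h.
move: FA; apply/negP; rewrite -leNgt.
rewrite (condS _ _ lA).
under eq_eseriesr.
  move=> k _; have [_ [M lF]] := cF k; rewrite (condS _ _ lF); over.
rewrite -integral_nneseries//.
- apply: ge0_le_integral => //.
  + by move=> s _; exact: cond_ge0.
  + exact: measurable_cond_upd.
  + apply: ge0_emeasurable_sum => [k s _ _|k _]; first exact: cond_ge0.
    by apply: measurable_cond_upd; case: (cF k).
  + by move=> s _; rewrite leNgt; apply/negP.
- by move=> k; apply: measurable_cond_upd; case: (cF k).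
- by move=> k s _; exact: cond_ge0.
Qed.

Lemma cond_sub (A : set (nat -> S)) (F : nat -> set (nat -> S)) w :
  cyl A -> (forall k, cyl (F k)) -> A `<=` \bigcup_k F k ->
  cond 0 A w <= \sum_(k <oo) cond 0 (F k) w.
Proof.
move=> cA cF AF; rewrite leNgt; apply/negP => FA.
have : forall z : nat * (nat -> S), exists s,
    \sum_(k <oo) cond z.1 (F k) z.2 < cond z.1 A z.2 ->
    \sum_(k <oo) cond z.1.+1 (F k) (upd z.2 z.1 s)
      < cond z.1.+1 A (upd z.2 z.1 s).
  move=> [n v] /=.
  have [/(cond_lt_step cA cF)[s hs]|] :=
    pselect (\sum_(k <oo) cond n (F k) v < cond n A v); first by exists s.
  by exists point.
move=> /choice[f hf].
pose fix v n := if n is m.+1 then upd (v m) m (f (m, v m)) else w.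
have hv n : \sum_(k <oo) cond n (F k) (v n) < cond n A (v n).
  by elim: n => [//|n /(hf (n, v n))].
pose u i := v i.+1 i.
have vu n i : (i < n)%N -> v n i = u i.
  elim: n => [//|n ih]; rewrite ltnS leq_eqVlt => /orP[/eqP -> //|ni].
  by rewrite [LHS]/= /upd ltn_eqF// ih.
have [mA [N lA]] := cA.
have Au : A u.
  apply: (lA (v N)); first exact: vu.
  have := hv N; rewrite (cond_level _ lA)// indicE.
  have [/set_mem//|_] := boolP (v N \in A).
  by rewrite ltNge nneseries_ge0// => k _ _; exact: cond_ge0.
have [j _ Fu] := AF _ Au.
have [mF [M lF]] := cF j.
have := hv (maxn N M); apply/negP; rewrite -leNgt.
rewrite (cond_level _ lA) ?leq_maxl//.
apply: (@le_trans _ _ (cond (maxn N M) (F j) (v (maxn N M)))).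
  rewrite (cond_level _ lF) ?leq_maxr// lee_fin !indicE.
  have -> : v (maxn N M) \in F j.
    apply/mem_set; apply: lF Fu => i iM.
    by rewrite vu// leq_max iM orbT.
  by case: (_ \in _).
apply: le_trans (nneseries_lim_ge j.+1 _) => /=; last first.
  by move=> k _ _; exact: cond_ge0.
by rewrite big_nat_recr//= leeDr// sume_ge0// => k _; exact: cond_ge0.
Qed.

Definition cyl_type : Type := nat -> S.

HB.instance Definition _ := Pointed.on cyl_type.

Let cyl0 : cyl set0.
Proof. by split; [exact: measurable0|exists 0%N]. Qed.

Let cylU : setU_closed cyl.
Proof.
move=> A B [mA [N lA]] [mB [M lB]]; split; first exact: measurableU.
exists (maxn N M) => w v wv.
by move=> [/(level_le (leq_maxl N M) lA wv)|/(level_le (leq_maxr N M) lB wv)];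
  [left|right].
Qed.

Let cylC : setC_closed cyl.
Proof.
move=> A [mA [N lA]]; split; first exact: measurableC.
by exists N => w v wv nA /(lA v w (fun i iN => esym (wv i iN))).
Qed.

HB.instance Definition _ := @isAlgebraOfSets.Build default_measure_display
  cyl_type cyl cyl0 cylU cylC.

Definition premeasure (A : set cyl_type) : \bar R := cond 0 A point.

Let premeasure0 : premeasure set0 = 0.
Proof.
by rewrite /premeasure (cond_level (N := 0))// indicE in_set0.
Qed.

Let premeasure_additive : measure_function.semi_additive premeasure.
Proof.
by apply/(additive2P premeasure0) => A B mA mB AB0; exact: cond_add.
Qed.

HB.instance Definition _ := isContent.Build _ cyl_type R premeasure
  (fun A => cond_ge0 0 A point) premeasure_additive.

Let premeasure_sub : measurable_subset_sigma_subadditive premeasure.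
Proof. by move=> A F mF mA; exact: cond_sub. Qed.

HB.instance Definition _ := Content_SigmaSubAdditive_isMeasure.Build _ R
  cyl_type premeasure premeasure_sub.

Definition chain_measure (A : set (infpath S)) : \bar R :=
  measure_extension premeasure A.

Let sub_cyl (A : set (infpath S)) : measurable A -> <<s cyl >> A.
Proof.
apply: smallest_sub; first exact: smallest_sigma_algebra.
move=> _ [i [B [mB ->]]]; apply: sub_gen_smallest; split.
  by apply: sub_sigma_algebra; exists i, B.
by exists i.+1 => w v wv /=; rewrite wv.
Qed.

Let chain_measure_sigma_additive : semi_sigma_additive chain_measure.
Proof.
move=> F mF tF mUF.
apply: (@measure_semi_sigma_additive _ _ _ (measure_extension premeasure)) => //.
  by move=> i; exact: sub_cyl.
exact: sub_cyl.
Qed.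

HB.instance Definition _ := isMeasure.Build _ _ _ chain_measure
  (measure0 (measure_extension premeasure))
  (fun A => measure_ge0 (measure_extension premeasure) A)
  chain_measure_sigma_additive.

Lemma chain_measureE A : cyl A -> chain_measure A = cond 0 A point.
Proof. by move=> cA; exact: measurable_mu_extE. Qed.

Let chain_measureT : chain_measure setT = 1.
Proof.
rewrite chain_measureE; last first.
  by split; [exact: measurableT|exists 0%N].
by rewrite (cond_level (N := 0))// indicT.
Qed.

HB.instance Definition _ :=
  Measure_isProbability.Build _ _ _ chain_measure chain_measureT.

Let rect (A : nat -> set S) N := [set w : nat -> S | forall i, (i < N)%N -> A i (w i)].

Lemma run_rect (A : nat -> set S) k m w : (forall i, measurable (A i)) ->
  run m.+1 k (rect A (m.+1 + k)) w =
  if w \in rect A m.+1 then cylinder_mass kappa (fun i => A (m.+1 + i)%N) k (w m)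
  else 0.
Proof.
move=> mA; elim: k m w => [|k ih] m w.
  by rewrite addn0 /= indicE; case: ifP.
rewrite [LHS]/= -addSnnS.
under eq_integral do rewrite ih.
have updE s : (upd w m.+1 s \in rect A m.+2) = (w \in rect A m.+1) && (s \in A m.+1).
  apply/idP/andP; rewrite !inE.
    move=> h; split => [i im|]; last first.
      by have := h m.+1 (ltnSn _); rewrite /upd eqxx.
    by have := h i (ltnW im); rewrite /upd ltn_eqF.
  move=> [h As] i; rewrite ltnS leq_eqVlt => /orP[/eqP ->|im].
    by rewrite /upd eqxx.
  by rewrite /upd ltn_eqF//; exact: h.
under eq_integral do rewrite updE.
case: (w \in rect A m.+1) => /=; last by rewrite integral0.
rewrite addn0 [RHS]integral_mkcond; apply: eq_integral => s _.
rewrite patchE /upd eqxx.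
by under [in RHS]eq_fun do rewrite addnS.
Qed.

Lemma chain_measure_law : is_chain_law kappa mu chain_measure.
Proof.
move=> A n mA; rewrite (_ : [set w | _] = rect A n.+1)//.
have lR : level n.+1 (rect A n.+1).
  by move=> w v wv h i im; rewrite -wv//; exact: h.
rewrite [LHS]chain_measureE; last first.
  by split; [exact: measurable_rectangle|exists n.+1].
rewrite (condE (m := n.+1) _ lR)// [LHS]/=.
rewrite [RHS]integral_mkcond; apply: eq_integral => s _.
rewrite patchE; apply: etrans (run_rect n 0 _ mA) _.
have -> : (upd (point : cyl_type) 0 s \in rect A 1) = (s \in A 0%N).
  apply/idP/idP; rewrite !inE; first by move=> /(_ 0%N); rewrite /upd; exact.
  by move=> As [|].
by [].
Qed.

Theorem chain_law_exists :
  exists P : probability (infpath S) R, is_chain_law kappa mu P.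
Proof. by exists chain_measure; exact: chain_measure_law. Qed.

End step.

End IonescuTulcea.

Section sts.
Context d (S : measurableType d) (R : realType).
Implicit Types (kappa : R.-pker S ~> S) (mu : probability S R).
Implicit Types (A B C : set S) (n : nat).

(* well defined on measurable sets by chain_law_unique *)
Definition Prob kappa mu : probability (infpath S) R :=
  sval (cid (IonescuTulcea.chain_law_exists kappa mu)).

Lemma ProbP kappa mu : is_chain_law kappa mu (Prob kappa mu).
Proof. exact: svalP (cid (IonescuTulcea.chain_law_exists kappa mu)). Qed.

Definition eventually_in B : set (infpath S) :=
  [set w : nat -> S | exists i, B (w i)].

Definition eventually_within n B : set (infpath S) :=
  [set w : nat -> S | exists i, (i <= n)%N /\ B (w i)].

Definition until_within n A C : set (infpath S) :=
  [set w : nat -> S | exists i, [/\ (i <= n)%N, C (w i) &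
    forall j, (j < i)%N -> A (w j)]].

Definition avoid_set kappa B : set S :=
  [set s | Prob kappa (dirac s) (eventually_in B) = 0].

Definition decisive kappa mu B : Prop :=
  Prob kappa mu (eventually_in B `|` eventually_in (avoid_set kappa B)) = 1.

Definition p_yes kappa mu B n : R :=
  fine (Prob kappa mu (eventually_within n B)).

Definition p_no kappa mu B n : R :=
  fine (Prob kappa mu (until_within n (~` B) (avoid_set kappa B))).

End sts.

Definition adjacent_sequences (R : realType) (u v : nat -> R) : Prop :=
  ((nondecreasing_seq u /\ nonincreasing_seq v) \/
   (nonincreasing_seq u /\ nondecreasing_seq v)) /\
  (u n - v n @[n --> \oo] --> 0)%R.

(* Main.v *)
(* A state of the avoid-set lies outside B and the chain started there a.s.
   stays outside B; by the Markov property a path visiting the avoid-set at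
   time i a.s. does not visit B later. Hence "eventually B" and "not B until
   avoid-set" intersect in a null set, and decisiveness says that their union
   has probability 1. Both sequences are then limits of probabilities along
   increasing unions. *)
Require Import Defs.
From mathcomp Require Import all_boot all_order all_algebra.
From mathcomp Require Import all_classical all_reals all_analysis.
From mathcomp Require Import measurable_realfun.
Import Order.TTheory GRing.Theory Num.Theory.
Import numFieldNormedType.Exports.
Local Open Scope classical_set_scope.
Local Open Scope ring_scope.

Section decisiveness.
Context {d : measure_display} {S : measurableType d} {R : realType}.
Variable kappa : R.-pker S ~> S.
Implicit Types (A B C : set S) (mu : probability S R).
Local Open Scope ereal_scope.

(** * Cylinder masses, bounded reachability and the avoid-set *)

Lemma cylinder_mass_ge0 (D : nat -> set S) n s : 0 <= cylinder_mass kappa D n s.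
Proof.
by elim: n D s => [|n ih] D s //=; exact: integral_ge0.
Qed.

Lemma measurable_cylinder_mass (D : nat -> set S) n :
  (forall i, measurable (D i)) ->
  measurable_fun [set: S] (cylinder_mass kappa D n).
Proof.
elim: n D => [|n ih] D mD /=; first exact: measurable_cst.
under eq_fun do rewrite integral_mkcond.
apply: measurable_fun_integral_kernel => [U mU|t|].
- exact: measurable_kernel.
- by rewrite patchE; case: ifP => // _; exact: cylinder_mass_ge0.
- apply/(measurable_restrictT _ (mD 0%N)).
  by apply: (measurable_funS measurableT) => //; exact: ih.
Qed.

Lemma measurable_eventually_within n B : measurable B ->
  measurable (eventually_within n B).
Proof.
move=> mB; rewrite (_ : eventually_within n B =
    \bigcup_(i in [set i | (i <= n)%N]) [set w : nat -> S | B (w i)]).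
  by apply: bigcup_measurable => i _; exact: measurable_coordinate.
by apply/seteqP; split => [w [i [im Bw]]|w [i im Bw]]; exists i.
Qed.

Lemma bigcup_eventually_within B :
  \bigcup_n eventually_within n B = eventually_in B.
Proof.
apply/seteqP; split => [w [n _ [i [_ Bw]]]|w [i Bw]]; first by exists i.
by exists i => //; exists i.
Qed.

Lemma measurable_eventually_in B : measurable B -> measurable (eventually_in B).
Proof.
move=> mB; rewrite -bigcup_eventually_within.
by apply: bigcupT_measurable => n; exact: measurable_eventually_within.
Qed.

Lemma Prob_eventually_within_dirac n B s : measurable B ->
  Prob kappa (dirac s) (eventually_within n B) =
  1 - \d_s (~` B) * cylinder_mass kappa (fun=> ~` B) n s.
Proof.
move=> mB; have mC : measurable (~` B) by exact: measurableC.
rewrite -[eventually_within n B]setCK probability_setC; last first.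
  by apply: measurableC; exact: measurable_eventually_within.
congr (_ - _).
rewrite (_ : ~` _ = [set w | forall i, (i <= n)%N -> (~` B) (w i)]); last first.
  apply/seteqP; split => [w h i im Bw|w h [i [im]]]; last exact: h.
  by apply: h; exists i.
rewrite (ProbP kappa (dirac s) n (fun=> mC)) integral_dirac//.
by apply: (measurable_funS measurableT) => //; exact: measurable_cylinder_mass.
Qed.

(** [eventually_in B] is a countable union of bounded events, so it is null iff each of them is.
    This trades the path law for explicit cylinder masses. *)
Lemma avoid_setP B s : measurable B -> avoid_set kappa B s <->
  ~ B s /\ forall n, cylinder_mass kappa (fun=> ~` B) n s = 1.
Proof.
move=> mB.
have mE n := measurable_eventually_within n _ mB.
have -> : avoid_set kappa B s <->
    forall n, Prob kappa (dirac s) (eventually_within n B) = 0.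
  rewrite /avoid_set /= -bigcup_eventually_within; split => [h n|h].
    apply: subset_measure0 h => //; last by move=> w Ew; exists n.
    exact: bigcupT_measurable.
  apply/negligibleP; first exact: bigcupT_measurable.
  apply: negligible_bigcup => n; apply/negligibleP; [exact: mE|exact: h].
have [Bs|nBs] := pselect (B s).
  (* For s in B the event of horizon 0 already has probability 1. *)
  split=> [/(_ 0%N)|[]//].
  rewrite Prob_eventually_within_dirac// diracE memNset; last by move=> /(_ Bs).
  by rewrite mul0e sube0 => /eqP; rewrite onee_eq0.
split=> [h|[_ h] n].
  split=> // n; move: (h n); rewrite Prob_eventually_within_dirac//.
  rewrite diracE mem_set// mul1e => /eqP.
  have := cylinder_mass_ge0 (fun=> ~` B) n s.
  (* The infinite values are ruled out by nonnegativity and by the equation. *)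
  case: cylinder_mass => [r _|//|//]; rewrite -EFinB eqe subr_eq0.
  by move=> /eqP <-.
by rewrite Prob_eventually_within_dirac// h diracE mem_set// mule1 subee.
Qed.

(** [Prob kappa (dirac s)] is chosen separately for each s, so measurability in s is read off from
    the cylinder masses of [avoid_setP]. *)
Lemma measurable_avoid_set B : measurable B -> measurable (avoid_set kappa B).
Proof.
move=> mB.
rewrite (_ : avoid_set kappa B = ~` B `&`
    \bigcap_n (cylinder_mass kappa (fun=> ~` B) n @^-1` [set 1])); last first.
  apply/seteqP; split=> s; last first.
    by move=> [? h]; apply/(avoid_setP _ _ mB); split=> // n; exact: h.
  by move=> /(avoid_setP _ _ mB)[? h]; split=> // n _; exact: h.
apply: measurableI; first exact: measurableC.
apply: bigcapT_measurable => n; rewrite -[X in measurable X]setTI.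
by apply: measurable_cylinder_mass => // _; exact: measurableC.
Qed.

(** * No visit to B after the avoid-set *)

(** Constraint on the state at time j: none before i, [A] at i, [C] afterwards. Such a product form
    is what [is_chain_law] evaluates. *)
Let pinned A C i j := if (j < i)%N then setT else if j == i then A else C.

(* States of A stay in C with full mass, so constraining the m steps after
   time i changes nothing. *)
Lemma integral_cylinder_mass_pinned A C i m (nu : {measure set S -> \bar R}) :
  (forall s n, A s -> cylinder_mass kappa (fun=> C) n s = 1) ->
  \int[nu]_(s in pinned A C i 0)
    cylinder_mass kappa (fun j => pinned A C i j.+1) (i + m) s =
  \int[nu]_(s in pinned A C i 0)
    cylinder_mass kappa (fun j => pinned A C i j.+1) i s.
Proof.
move=> AC; elim: i nu => [|i ih] nu.
  by apply: eq_integral => s /set_mem As; rewrite AC.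
(* Dropping the first state turns [pinned A C i.+1] into [pinned A C i] by conversion, with
   [kappa s] as the new initial measure. *)
by apply: eq_integral => s _; exact: (ih (kappa s)).
Qed.

Lemma Prob_avoid_set_then mu B i k : measurable B -> (i < k)%N ->
  Prob kappa mu [set w : nat -> S | avoid_set kappa B (w i) /\ B (w k)] = 0.
Proof.
move=> mB ik; have mA := measurable_avoid_set _ mB.
pose D := pinned (avoid_set kappa B) (~` B) i.
have mD j : measurable (D j).
  by rewrite /D /pinned; do 2?case: ifP => // _; exact: measurableC.
have kE : (i + (k - i))%N = k by rewrite subnKC// ltnW.
(* [E i] only asks for the avoid-set at time i; [E k] also keeps the path outside B at times i+1 to
   k. Their probabilities agree, so [E i] minus [E k] is null, and it contains the event. *)
pose E n : set (infpath S) := [set w | forall j, (j <= n)%N -> D j (w j)].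
have mE n : measurable (E n) by exact: measurable_rectangle.
have PE : Prob kappa mu (E k) = Prob kappa mu (E i).
  rewrite !(ProbP kappa mu _ mD) -[in LHS]kE integral_cylinder_mass_pinned//.
  by move=> s n /(avoid_setP _ _ mB)[].
have Eki : E i `&` E k = E k.
  by apply/setIidPr => w h j ji; apply: h; exact: leq_trans ji (ltnW ik).
have : Prob kappa mu (E i `\` E k) = 0.
  rewrite measureD//; last by rewrite -ge0_fin_numE// fin_num_measure.
  by rewrite Eki [X in _ - X]PE subee// fin_num_measure.
apply: subset_measure0.
- apply: measurableI; exact: measurable_coordinate.
- exact: measurableD.
move=> w [Aw Bw]; split=> [j|/(_ k (leqnn _))].
  rewrite leq_eqVlt /D /pinned => /orP[/eqP ->|->//].
  by rewrite ltnn eqxx.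
by rewrite /D /pinned ltnNge (ltnW ik) gtn_eqF.
Qed.

(** * Until events, decisiveness and limits *)

Lemma measurable_until_within n A C : measurable A -> measurable C ->
  measurable (until_within n A C).
Proof.
move=> mA mC; rewrite (_ : until_within n A C =
    \bigcup_(i in [set i | (i <= n)%N]) ([set w : nat -> S | C (w i)] `&`
      \bigcap_(j in [set j | (j < i)%N]) [set w : nat -> S | A (w j)])).
  apply: bigcup_measurable => i _; apply: measurableI.
    exact: measurable_coordinate.
  by apply: bigcap_measurableType => j _; exact: measurable_coordinate.
apply/seteqP; split => w; first by move=> [i [im Cw Aw]]; exists i.
by move=> [i im [Cw Aw]]; exists i.
Qed.

Lemma Prob_eventually_in_and_until mu B : measurable B ->
  Prob kappa mu (eventually_in B `&`
    \bigcup_n until_within n (~` B) (avoid_set kappa B)) = 0.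
Proof.
move=> mB; have mA := measurable_avoid_set _ mB.
have mU n := measurable_until_within n _ _ (measurableC mB) mA.
have mW i k : measurable ([set w : nat -> S |
    avoid_set kappa B (w i) /\ B (w k)] : set (infpath S)).
  by apply: measurableI; exact: measurable_coordinate.
apply/negligibleP.
  apply: measurableI; first exact: measurable_eventually_in.
  exact: bigcupT_measurable.
pose W i k : set (infpath S) := if (i < k)%N then
  [set w : nat -> S | avoid_set kappa B (w i) /\ B (w k)] else set0.
(* A visit to B must come strictly after the avoid-set: the until condition forbids an earlier one,
   and disjointness of B and the avoid-set a simultaneous one. *)
have sub : eventually_in B `&`
    \bigcup_n until_within n (~` B) (avoid_set kappa B) `<=`
    \bigcup_i \bigcup_k W i k.
  move=> w [[k Bw] [n _ [i [_ Aw nB]]]]; exists i => //; exists k => //.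
  have [nBi _] := (avoid_setP _ _ mB).1 Aw; rewrite /W.
  have [//|ki|ik] := ltngtP i k; first by have := nB _ ki.
  by move: Bw; rewrite -ik.
apply: negligibleS sub _.
apply: negligible_bigcup => i; apply: negligible_bigcup => k.
rewrite /W; case: ifP => ik; last exact: negligible_set0.
by apply/negligibleP => //; exact: Prob_avoid_set_then.
Qed.

Lemma Prob_until_avoid_set mu B : measurable B -> decisive kappa mu B ->
  Prob kappa mu (\bigcup_n until_within n (~` B) (avoid_set kappa B)) =
  1 - Prob kappa mu (eventually_in B).
Proof.
move=> mB dec; have mA := measurable_avoid_set _ mB.
have mF := measurable_eventually_in _ mB.
set U := \bigcup_n _.
have mU : measurable U.
  apply: bigcupT_measurable => n; apply: measurable_until_within => //.
  exact: measurableC.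
(* On a path that never meets B the until constraint is automatic, so there reaching the avoid-set
   amounts to [U]. The new union is disjoint. *)
have FU : eventually_in B `|` eventually_in (avoid_set kappa B) =
    eventually_in B `|` (U `\` eventually_in B).
  apply/seteqP; split => w [Bw|]; try by left.
    move=> [i Aw]; have [Bw|nBw] := pselect (eventually_in B w); first by left.
    right; split=> //; exists i => //; exists i; split => // j _ Bj.
    by apply: nBw; exists j.
  by move=> [[n _ [i [_ Aw _]]] _]; right; exists i.
move: dec; rewrite /decisive FU measureU//; last 2 first.
- exact: measurableD.
- by rewrite setDE setICA setICr setI0.
rewrite measureD//; last by rewrite -ge0_fin_numE// fin_num_measure.
(* Removing the null overlap leaves the probability of [U] unchanged. *)
rewrite setIC [X in _ - X]Prob_eventually_in_and_until// sube0 => <-.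
by rewrite [X in X - _]addeC addeK// fin_num_measure.
Qed.

(** Continuity from below, transferred to real values since probabilities are finite; it serves both
    sequences. *)
Lemma cvg_fine_probability_bigcup d' (T : measurableType d')
    (P : probability T R) (F : nat -> set T) :
  (forall n, measurable (F n)) -> {homo F : m n / (m <= n)%N >-> m `<=` n} ->
  nondecreasing_seq (fun n => fine (P (F n))) /\
  fine (P (F n)) @[n --> \oo] --> fine (P (\bigcup_n F n)).
Proof.
move=> mF ndF; split=> [m n mn|].
  by apply: fine_le; rewrite ?fin_num_measure// le_measure ?inE//; exact: ndF.
apply: fine_cvg; rewrite fineK; last first.
  by apply: fin_num_measure; exact: bigcupT_measurable.
apply: nondecreasing_cvg_mu => //; first exact: bigcupT_measurable.
by move=> m n mn; apply/subsetPset/ndF.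
Qed.

End decisiveness.

Theorem proposition57 (d : measure_display) (S : measurableType d) (R : realType)
    (kappa : R.-pker S ~> S) (mu : probability S R) (B : set S)
    (mB : measurable B) (hdec : decisive kappa mu B) :
  [/\ adjacent_sequences (p_yes kappa mu B) (fun n => 1 - p_no kappa mu B n),
      p_yes kappa mu B n @[n --> \oo] --> fine (Prob kappa mu (eventually_in B)) &
      1 - p_no kappa mu B n @[n --> \oo] --> fine (Prob kappa mu (eventually_in B))].
Proof.
have mA := measurable_avoid_set kappa _ mB.
have [ndY cvgY] : nondecreasing_seq (p_yes kappa mu B) /\
    p_yes kappa mu B n @[n --> \oo] --> fine (Prob kappa mu (eventually_in B)).
  rewrite -bigcup_eventually_within.
  apply: cvg_fine_probability_bigcup => [n|m n mn w].
    exact: measurable_eventually_within.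
  by move=> [i [im Bw]]; exists i; split=> //; exact: leq_trans im mn.
have [ndN cvgN] : nondecreasing_seq (p_no kappa mu B) /\
    p_no kappa mu B n @[n --> \oo] -->
      1 - fine (Prob kappa mu (eventually_in B)).
  (* Decisiveness enters here, identifying the limit of [p_no]. *)
  have -> : 1 - fine (Prob kappa mu (eventually_in B)) = fine (Prob kappa mu
      (\bigcup_n until_within n (~` B) (avoid_set kappa B))).
    rewrite Prob_until_avoid_set// fineB// fin_num_measure//.
    exact: measurable_eventually_in.
  apply: cvg_fine_probability_bigcup => [n|m n mn w].
    by apply: measurable_until_within => //; exact: measurableC.
  by move=> [i [im Aw Bw]]; exists i; split=> //; exact: leq_trans im mn.
have cvgN' : 1 - p_no kappa mu B n @[n --> \oo] -->
    fine (Prob kappa mu (eventually_in B)).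
  by rewrite -[X in _ --> X](subKr 1); apply: cvgB => //; exact: cvg_cst.
split=> //; split.
  by left; split=> // m n mn; rewrite lerB// ndN.
by rewrite -[X in _ --> X](subrr (fine (Prob kappa mu (eventually_in B))));
  apply: cvgB.
Qed.
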